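(* For all $0<\eta \ll \alpha\ll 1$, there is an $n_0$ such that if $H$ is a $3$-graph on $n\geq n_0$ vertices with $\delta_1(H) \geq \left(\frac{5}{9} - 10\eta\right){n\choose 2}$, then either $H$ contains a matching leaving strictly less than $\eta^2 n$ vertices unmatched, or $H$ is $\alpha$-extremal.
   Context: A $3$-graph $H$ is a $3$-uniform hypergraph; a matching is a set of pairwise disjoint edges. $\delta_1(H)$ denotes the minimum, over all vertices $v$, of the number of edges containing $v$. For a set $U\subset V(H)$, $d_3(U) = |E(H|_U)|/{|U|\choose 3}$ is the edge density of the subhypergraph induced on $U$. For a constant $0<\alpha<1$, $H$ is called $\alpha$-extremal if there exists a set $B\subset V(H)$ with $|B|\geq \left(\frac{2}{3}-\alpha\right)n$ and $d_3(B)<\alpha$; otherwise $H$ is $\alpha$-non-extremal. *)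

(* Defs.v *)
From HB Require Import structures.
From mathcomp Require Import all_boot all_order all_algebra.
From mathcomp Require Import reals.
Set Implicit Arguments. Unset Strict Implicit. Unset Printing Implicit Defensive.
Import Order.TTheory GRing.Theory Num.Theory.
Local Open Scope ring_scope.

Definition is_3graph (n : nat) (E : {set {set 'I_n}}) : Prop :=
  forall e, e \in E -> #|e| = 3%N.

Definition deg (n : nat) (E : {set {set 'I_n}}) (v : 'I_n) : nat :=
  #|[set e in E | v \in e]|.

Definition min_deg_ge (R : realType) (n : nat) (E : {set {set 'I_n}}) (t : R) : Prop :=
  forall v : 'I_n, t <= (deg E v)%:R.

Definition is_matching (n : nat) (E M : {set {set 'I_n}}) : Prop :=
  M \subset E /\ (forall e f, e \in M -> f \in M -> e != f -> [disjoint e & f]).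

Definition unmatched (n : nat) (M : {set {set 'I_n}}) : nat :=
  #|~: cover M|.

Definition d3 (R : realType) (n : nat) (E : {set {set 'I_n}}) (U : {set 'I_n}) : R :=
  (#|[set e in E | e \subset U]|)%:R / ('C(#|U|, 3))%:R.

Definition extremal (R : realType) (n : nat) (alpha : R) (E : {set {set 'I_n}}) : Prop :=
  exists B : {set 'I_n},
    (2%:R / 3%:R - alpha) * n%:R <= (#|B|)%:R /\ @d3 R n E B < alpha.

(* Main.v *)
(** Let [M] be a maximum matching, [X] the set of uncovered vertices, and suppose
    [#|X| >= eta^2 n]. Call a pair of vertices rich if it forms an edge with many
    vertices of [X]: disjoint rich pairs extend greedily to disjoint edges, so no
    [s] edges of [M] can be traded for [s + 1] disjoint rich pairs and edges.
    Between two edges [e], [f] of [M] the rich pairs form a 3x3 bipartite graph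
    without perfect matching. A complete K_{2,3}, even with one pair missing, can
    be exploited once it occurs on three [e]'s and two [f]'s, so it is rare by the
    Kővári–Sós–Turán argument; otherwise there are at most 5 rich pairs, with 5
    only if some centre in [e] is joined to all of [f] and some centre in [f] to
    all of [e] ("linked" edges). As the degrees of the vertices of [X] force
    5/9 - O(eta) of all pairs to be rich, [X] has size O(eta n) and all but
    O(eta n^2) pairs of edges are linked. In a triangle of linked edges the centres
    agree, and no edge of the hypergraph meets the three edges of a triangle outside
    their centres. Hence the complement of the set of centres is sparse. *)
Require Import Defs.
From HB Require Import structures.
From mathcomp Require Import all_boot all_order all_algebra.
From mathcomp Require Import reals.
From mathcomp Require Import zify ring lra.
Import Order.TTheory GRing.Theory Num.Theory.
Set Implicit Arguments. Unset Strict Implicit. Unset Printing Implicit Defensive.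
Local Open Scope ring_scope.

(** * Cauchy-Schwarz and Kővári-Sós-Turán counting in natural numbers *)

Section Counting.
Local Open Scope nat_scope.
Variable I : finType.
Implicit Type A : {set I}.

(** Cauchy-Schwarz, by summing [2 d_i d_j <= d_i^2 + d_j^2] over all ordered pairs. *)
Lemma sqr_sum_le A (d : I -> nat) :
  (\sum_(i in A) d i) ^ 2 <= #|A| * \sum_(i in A) d i ^ 2.
Proof.
rewrite -(leq_pmul2l (isT : 0 < 2)).
have -> : 2 * (\sum_(i in A) d i) ^ 2 = \sum_(i in A) \sum_(j in A) 2 * (d i * d j).
  rewrite expnS expn1 big_distrlr /= big_distrr /=.
  by apply: eq_bigr => i _; rewrite big_distrr.
have -> : 2 * (#|A| * \sum_(i in A) d i ^ 2) =
    \sum_(i in A) \sum_(j in A) (d i ^ 2 + d j ^ 2).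
  under [RHS]eq_bigr do rewrite big_split /= sum_nat_const.
  by rewrite big_split /= sum_nat_const -big_distrr /= mul2n addnn.
by do 2!apply: leq_sum => ? _; exact: nat_Cauchy.
Qed.

(* Double counting of the pairs [f, f'] with a common neighbour, as in the
   Kővári–Sós–Turán bound for K_{3,2}-free relations. *)
Lemma K32_free_sum A (R : rel I) :
    {in A &, forall f f', f != f' -> #|[set e in A | R e f && R e f']| <= 2} ->
  (\sum_(e in A) \sum_(f in A) R e f) ^ 2 <= 3 * #|A| ^ 3.
Proof.
move=> common; apply: leq_trans (sqr_sum_le _ _) _.
rewrite [#|A| ^ 3]expnS mulnCA leq_mul2l; apply/orP; right.
under eq_bigr do rewrite expnS expn1 big_distrlr /=.
(* The diagonal [f' = f] contributes at most [#|A|], every other [f'] at most 2. *)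
rewrite exchange_big /=; apply: (@leq_trans (\sum_(f in A) (#|A| + 2 * #|A|))).
  apply: leq_sum => f fA; rewrite exchange_big /= (bigD1 f) //= leq_add //.
    rewrite -sum1_card; apply: leq_sum => e _; by case: (R e f).
  apply: (@leq_trans (\sum_(j in A | j != f) 2)); last first.
    rewrite big_mkcondr /= mulnC -sum_nat_const; apply: leq_sum => j _; by case: ifP.
  apply: leq_sum => f' /andP[f'A ff']; rewrite eq_sym in ff'.
  apply: leq_trans (common f f' fA f'A ff'); rewrite -sum1_card.
  rewrite [leqRHS](eq_bigl (fun e => (e \in A) && (R e f && R e f'))); last first.
    by move=> e; rewrite inE.
  by rewrite [leqRHS]big_mkcondr /=; apply: leq_sum => e _; case: (R e f); case: (R e f').
by rewrite sum_nat_const expnS expn1; lia.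
Qed.

(** Working with squares keeps the root of the Kővári-Sós-Turán bound out of [nat]; the sum is at
    most [size s] times its largest term. *)
Lemma sqr_bigsum_max (K : Type) (s : seq K) (F : K -> nat) (C : nat) :
  (forall k, F k ^ 2 <= C) -> (\sum_(k <- s) F k) ^ 2 <= size s ^ 2 * C.
Proof.
move=> FC; pose m := \max_(k <- s) F k.
have sm : \sum_(k <- s) F k <= size s * m.
  rewrite /m; elim: s {m} => [|k s IH]; first by rewrite big_nil.
  rewrite !big_cons /= mulSn leq_add ?leq_maxl //; apply: leq_trans IH _.
  by rewrite leq_mul2l leq_maxr orbT.
have mC : m ^ 2 <= C.
  rewrite /m; elim/big_ind: _ => // x y xC yC; rewrite /maxn; by case: ifP.
by apply: leq_trans (leq_mul (leqnn _) mC); rewrite -expnMn leq_exp2r.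
Qed.

End Counting.

(** * Rich pairs between two edges as 3x3 boolean matrices *)

Section BooleanMatrices.
Local Open Scope nat_scope.

Definition perms3 := [:: [:: 0; 1; 2]; [:: 0; 2; 1]; [:: 1; 0; 2];
                         [:: 1; 2; 0]; [:: 2; 0; 1]; [:: 2; 1; 0]].
Definition perm_pairs := [seq (s, t) | s <- perms3, t <- perms3].

Implicit Type r : nat -> nat -> bool.
Definition has_perfect r :=
  has (fun s => [&& r 0 (nth 0 s 0), r 1 (nth 0 s 1) & r 2 (nth 0 s 2)]) perms3.
(** K_{2,3} minus one pair, with the rows in the order [s] and the columns in the order [t]; the
    third row is unconstrained. *)
Definition has_pattern23 r :=
  has (fun p => let: (s, t) := p in
    [&& r (nth 0 s 0) (nth 0 t 0), r (nth 0 s 0) (nth 0 t 1), r (nth 0 s 0) (nth 0 t 2),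
        r (nth 0 s 1) (nth 0 t 0) & r (nth 0 s 1) (nth 0 t 1)]) perm_pairs.
(** Row [i] and column [j] are full: the centres of linked edges in matrix form. *)
Definition has_cross r :=
  has (fun i => has (fun j => all (fun k => r i k && r k j) (iota 0 3)) (iota 0 3)) (iota 0 3).
Definition weight3 r :=
  r 0 0 + r 0 1 + r 0 2 + (r 1 0 + r 1 1 + r 1 2) + (r 2 0 + r 2 1 + r 2 2).

(** Checked on all 512 matrices. Without a perfect matching and without the pattern in either
    orientation the weight is at most 5, and weight 5 forces a cross. *)
Lemma matrix3_cases r :
  [|| has_perfect r, has_pattern23 r, has_pattern23 (fun i j => r j i),
      weight3 r <= 4 | has_cross r && (weight3 r <= 5)].
Proof.
rewrite /has_perfect /has_pattern23 /has_cross /weight3 /=.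
move: (r 0 0) (r 0 1) (r 0 2) (r 1 0) (r 1 1) (r 1 2) (r 2 0) (r 2 1) (r 2 2).
by do 9!case.
Qed.

End BooleanMatrices.

(** * Rich pairs and exchanges at a maximum matching *)

Section MaximumMatching.
Local Open Scope nat_scope.

Variables (T : finType) (E M : {set {set T}}).
Hypothesis E3 : forall e, e \in E -> #|e| = 3.
Hypothesis ME : M \subset E.
Hypothesis triM : trivIset M.
Hypothesis maxM : forall N : {set {set T}}, N \subset E -> trivIset N -> #|N| <= #|M|.

Let X := ~: cover M.

(* 18 = 3 * 6: the largest exchange uses 6 rich pairs, hence blocks at most 18
   vertices of [X]. *)
Definition rich (a b : T) := 18 <= #|[set x in X | [set a; b; x] \in E]|.

Lemma richC a b : rich a b = rich b a.
Proof. by rewrite /rich; under eq_finset do rewrite (setUC [set a]). Qed.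

Lemma M3 e : e \in M -> #|e| = 3.
Proof. by move=> eM; apply/E3/(subsetP ME). Qed.

Definition ends (P : seq (T * T)) := flatten [seq [:: p.1; p.2] | p <- P].

Lemma size_ends P : size (ends P) = (size P).*2.
Proof. by rewrite /ends; elim: P => //= p P ->. Qed.

Lemma trivIset_setU1 (A : {set T}) (N : {set {set T}}) :
  trivIset N -> A != set0 -> [disjoint A & cover N] ->
  trivIset (A |: N) /\ A \notin N.
Proof.
move=> tN A0 dA; split.
  by apply: trivIsetU => //; [exact: trivIset1 | rewrite cover1].
apply/negP => AN; have /set0Pn[x xA] := A0.
by move/disjointFr: dA => /(_ x xA) /negP; apply; apply/bigcupP; exists A.
Qed.

Lemma coverU1 (A : {set T}) (N : {set {set T}}) : cover (A |: N) = A :|: cover N.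
Proof. by rewrite /cover bigcup_setU big_set1. Qed.

(** Greedy choice of a third vertex in [X] for each pair. The budget of 18 survives each step: the
    new edge meets [X] in at most 3 vertices ([a] and [b] may lie in [X] too), while [P] loses one
    pair. *)
Lemma complete_rich_pairs (P : seq (T * T)) (N : {set {set T}}) :
    N \subset E -> trivIset N -> all (fun p => rich p.1 p.2) P ->
    uniq (ends P) -> all (fun v => v \notin cover N) (ends P) ->
    #|cover N :&: X| + 3 * size P <= 18 ->
  exists N' : {set {set T}},
    [/\ N' \subset E, trivIset N' & #|N'| = #|N| + size P].
Proof.
elim: P N => [|[a b] P IH] N NE tN /=; first by move=> *; exists N; rewrite addn0.
case/andP=> rab rP; rewrite -/(ends P) => /and3P[aP bP uP] /and3P[aN bN PN] K.
pose C := [set x in X | [set a; b; x] \in E].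
(* The third vertex must avoid what [N] covers in [X] and the ends of the pairs still waiting. *)
pose F := (cover N :&: X) :|: [set:: ends P].
have cF : #|F| < #|C|.
  apply: leq_trans rab; apply: (@leq_trans (18 - 3).+1) => //; rewrite ltnS.
  apply: leq_trans (leq_card_setU _ _) _.
  have : #|[set:: ends P]| <= (size P).*2.
    by rewrite -size_ends cardsE; exact: card_size.
  by move: K; move: #|cover N :&: X| #|[set:: ends P]| (size P) => x y z; clear; lia.
have /subsetPn[x xC xF] : ~~ (C \subset F).
  by apply/negP => /subset_leq_card; rewrite leqNgt cF.
case/setIdP: xC => xX xE.
move: xF; rewrite in_setU in_setI xX andbT negb_or in_set => /andP[xN xP].
have c3 := E3 xE.
have dN : [disjoint [set a; b; x] & cover N].
  rewrite -setI_eq0; apply/eqP/setP => y; rewrite !inE.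
  by apply/negP => /andP[/orP[/orP[]|] /eqP->]; apply/negP.
have [tN' nN'] : trivIset ([set a; b; x] |: N) /\ [set a; b; x] \notin N.
  by apply: trivIset_setU1 => //; rewrite -card_gt0 c3.
case: (IH ([set a; b; x] |: N)) => //.
- by rewrite subUset sub1set xE.
- apply/allP => v vP; rewrite coverU1 !inE !negb_or (allP PN) // andbT.
  rewrite inE negb_or in aP; case/andP: aP => _ aP.
  apply/andP; split; [apply/andP; split|].
  - by apply: contraNneq aP => <-.
  - by apply: contraNneq bP => <-.
  - by apply: contraNneq xP => <-.
- rewrite coverU1 setIUl.
  have h3 : #|[set a; b; x] :&: X| <= 3 by rewrite -c3 subset_leq_card ?subsetIl.
  apply: leq_trans K; rewrite mulnS addnA leq_add2r addnC.
  by apply: leq_trans (leq_card_setU _ _) _; rewrite leq_add2r.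
- by move=> N' [N'E tN'' cN']; exists N'; split=> //; rewrite cN' cardsU1 nN' addnS.
Qed.

Lemma mem_X v : (v \in X) = (v \notin cover M). Proof. by rewrite inE. Qed.

(** Remove [S], insert [Q] and the completions of [P]: a count above [#|S|] would beat the maximum.
    Before completion the new matching misses [X], so six pairs fit the budget of 18. *)
Lemma no_augmentation (S Q : {set {set T}}) (P : seq (T * T)) :
    S \subset M -> Q \subset E -> trivIset Q -> cover Q \subset cover S ->
    size P <= 6 -> all (fun p => rich p.1 p.2) P -> uniq (ends P) ->
    all (fun v => (v \notin cover Q) && ((v \in cover S) || (v \in X))) (ends P) ->
  size P + #|Q| <= #|S|.
Proof.
move=> SM QE tQ QS P6 rP uP PS.
have dS v : v \in cover S -> v \notin cover (M :\: S).
  move=> /bigcupP[e eS ve]; apply/bigcupP => -[f /setDP[fM fS] vf].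
  have /trivIsetP/(_ e f (subsetP SM _ eS) fM) := triM.
  have -> : e != f by apply: contraNneq fS => <-.
  by move/(_ isT)/disjointFr/(_ ve); rewrite vf.
have coverDX v : v \in X -> v \notin cover (M :\: S).
  rewrite mem_X; apply: contra => /bigcupP[e /setDP[eM _] ve].
  by apply/bigcupP; exists e.
have dQ : [disjoint cover Q & cover (M :\: S)].
  rewrite -setI_eq0; apply/eqP/setP => v; rewrite !inE; apply/negP => /andP[vQ].
  by apply/negP/dS/(subsetP QS).
have tN : trivIset (Q :|: (M :\: S)) by apply: trivIsetU => //; apply: trivIsetD.
have coverN : cover (Q :|: (M :\: S)) = cover Q :|: cover (M :\: S).
  by rewrite /cover bigcup_setU.
have NX : cover (Q :|: (M :\: S)) :&: X = set0.
  apply/setP => v; rewrite in_setI coverN [in RHS]inE; apply/negP => /andP[vN vX].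
  move: vN; rewrite inE (negbTE (coverDX _ vX)) orbF => /(subsetP QS).
  case/bigcupP => e eS ve; move: vX; rewrite mem_X => /negP; apply.
  by apply/bigcupP; exists e => //; exact: (subsetP SM).
have cN : #|Q :|: (M :\: S)| = #|Q| + #|M| - #|S|.
  rewrite cardsU cardsDS // disjoint_setI0 ?cards0 ?subn0; last first.
    rewrite -setI_eq0; apply/eqP/setP => e; rewrite !inE; apply/negP => /and3P[eQ eS eM].
    have /card_gt0P[v ve] : 0 < #|e| by rewrite (E3 (subsetP QE _ eQ)).
    move/disjointFr: dQ => /(_ v); have -> : v \in cover Q by apply/bigcupP; exists e.
    by move=> /(_ isT) /negP; apply; apply/bigcupP; exists e; rewrite // !inE eS.
  by rewrite addnBA ?subset_leq_card.
case: (@complete_rich_pairs P (Q :|: (M :\: S))) => //.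
- by rewrite subUset QE /= (subset_trans (subsetDl _ _)).
- apply/allP => v /(allP PS) /andP[vQ vS]; rewrite coverN inE (negbTE vQ) /=.
  by case/orP: vS => [/dS|/coverDX].
- by rewrite NX cards0 add0n (leq_mul (leqnn 3) P6).
- move=> N' [N'E tN' cN']; have := maxM N'E tN'; rewrite cN' cN.
  have := subset_leq_card SM.
  by move: #|S| #|M| #|Q| (size P) => x y z w; clear; lia.
Qed.

(** * Exchanges written as lists of vertices *)

Definition edges_of (S : seq (seq T)) := [set:: [seq [set:: s] | s <- S]].

Lemma edges_of_cons s S : edges_of (s :: S) = [set:: s] |: edges_of S.
Proof. exact: set_cons. Qed.

Lemma cover_edges_of S : cover (edges_of S) = [set:: flatten S].
Proof.
elim: S => [|s S IH].
  rewrite /edges_of /= set_nil /cover big_set0; apply/setP => x.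
  by rewrite !inE.
by rewrite edges_of_cons coverU1 IH /=; apply/setP => x; rewrite !inE mem_cat.
Qed.

Lemma edges_of_uniq S : {subset [seq [set:: s] | s <- S] <= E} ->
  uniq (flatten S) -> trivIset (edges_of S) /\ #|edges_of S| = size S.
Proof.
elim: S => [_ _|s S IH SE /=].
  rewrite /edges_of /= set_nil cards0; split=> //.
  by apply/trivIsetP => A; rewrite inE.
rewrite cat_uniq => /and3P[us dS uS].
have [|tS cS] := IH _ uS; first by move=> e eS; apply: SE; rewrite inE eS orbT.
have sE : [set:: s] \in E by apply: SE; rewrite inE eqxx.
have [] := @trivIset_setU1 [set:: s] _ tS.
- by rewrite -card_gt0 E3.
- rewrite cover_edges_of -setI_eq0; apply/eqP/setP => x; rewrite !inE.
  by apply/negP => /andP[xs xS]; case/hasP: dS; exists x.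
by rewrite -edges_of_cons => t' n'; split=> //; rewrite edges_of_cons cardsU1 n' cS.
Qed.

Definition listed (e : {set T}) (s : seq T) := (size s == 3) && (e == [set:: s]).

Lemma listed_mem e s : listed e s -> e =i s.
Proof. by case/andP => _ /eqP-> x; rewrite inE. Qed.

Lemma listed_uniq e s : e \in M -> listed e s -> uniq s.
Proof.
move=> eM /andP[/eqP ss /eqP es]; apply/card_uniqP.
by rewrite ss -(M3 eM) es cardsE.
Qed.

Lemma listed_flatten_uniq (L : seq ({set T} * seq T)) :
    all (fun p => (p.1 \in M) && listed p.1 p.2) L -> uniq [seq p.1 | p <- L] ->
  uniq (flatten [seq p.2 | p <- L]).
Proof.
elim: L => //= -[e s] L IH /= /andP[/andP[eM es] LM] /andP[eL uL].
rewrite cat_uniq (listed_uniq eM es) IH // andbT /=.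
apply/hasPn => x /flattenP[t /mapP[[f t'] fL /= ->] xt]; apply/negP => /= xs.
have /andP[/= fM ft] := allP LM _ fL.
have /trivIsetP/(_ e f eM fM) := triM.
have -> : e != f by apply: contraNneq eL => ->; apply/mapP; exists (f, t').
move/(_ isT)/disjointFr => /(_ x); rewrite (listed_mem es) (listed_mem ft) xs xt.
by move/(_ isT).
Qed.

(** In list form all disjointness conditions collapse into one [uniq], so that a concrete exchange
    is checked by computation. *)
Lemma no_augmentation_seq (L : seq ({set T} * seq T)) (Q : seq (seq T)) (P : seq (T * T)) :
    all (fun p => (p.1 \in M) && listed p.1 p.2) L -> uniq [seq p.1 | p <- L] ->
    {subset [seq [set:: s] | s <- Q] <= E} -> size P <= 6 ->
    all (fun p => rich p.1 p.2) P -> uniq (flatten Q ++ ends P) ->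
    all (fun v => v \in flatten [seq p.2 | p <- L]) (flatten Q) ->
    all (fun v => (v \in flatten [seq p.2 | p <- L]) || (v \in X)) (ends P) ->
  size P + size Q <= size L.
Proof.
move=> LM uL QE P6 rP uQP QL PL.
have uF := listed_flatten_uniq LM uL.
move: uQP; rewrite cat_uniq => /and3P[uQ dQP uP].
have [tQ cQ] := edges_of_uniq QE uQ.
pose S := edges_of [seq p.2 | p <- L].
have SM : {subset [seq [set:: s] | s <- [seq p.2 | p <- L]] <= M}.
  move=> e /mapP[s /mapP[p /(allP LM) /andP[pM /andP[_ /eqP ps]] ->] ->].
  by rewrite -ps.
have [_ cS] : trivIset S /\ #|S| = size [seq p.2 | p <- L].
  by apply: edges_of_uniq => // e /SM; exact: (subsetP ME).
rewrite -cQ -(size_map (fun p => p.2) L) -cS; apply: no_augmentation => //.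
- by apply/subsetP => e; rewrite inE => /SM.
- by apply/subsetP => e; rewrite inE => /QE.
- by rewrite !cover_edges_of; apply/subsetP => v; rewrite !inE => /(allP QL).
- apply/allP => v vP; rewrite !cover_edges_of; apply/andP; split.
    by rewrite inE; apply/negP => vQ; case/hasP: dQP; exists v.
  by have := allP PL v vP; case/orP => vP'; [rewrite inE vP' | rewrite vP' orbT].
Qed.

(** Exchanges name vertices by their positions [I] in the flattened list of the removed edges;
    distinctness of the vertices reduces to that of the positions. *)
Lemma uniq_map_nth (x0 : T) (s : seq T) (I : seq nat) :
  uniq s -> uniq I -> all (fun i => i < size s) I -> uniq (map (nth x0 s) I).
Proof.
move=> us uI /allP Is; rewrite map_inj_in_uniq // => i j /Is si /Is sj /eqP.
by rewrite nth_uniq // => /eqP.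
Qed.

(** * Configurations of rich pairs that maximality excludes *)

Lemma nil_edges : {subset [::] <= E}. Proof. by []. Qed.

Lemma rich_neq a b : rich a b -> a != b.
Proof.
move=> rab; have /card_gt0P[x /setIdP[_ xE]] : 0 < #|[set x in X | [set a; b; x] \in E]|.
  exact: leq_trans rab.
apply/eqP => ab; have := E3 xE; rewrite ab setUid cards2; by case: eqP.
Qed.

(** A completed rich pair inside [X] would enlarge [M] without removing any edge. *)
Lemma not_rich_uncovered x y : x \in X -> y \in X -> ~~ rich x y.
Proof.
move=> xX yX; apply/negP => rxy.
have := @no_augmentation_seq [::] [::] [:: (x, y)]; rewrite /= rxy xX yX inE.
by rewrite rich_neq //; move/(_ isT isT nil_edges isT isT isT isT isT).
Qed.

Lemma list_card3 (e : {set T}) a : #|e| = 3 -> a \in e ->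
  exists b c, listed e [:: a; b; c].
Proof.
move=> c3 ae; have /eqP/cards2P[b [c [_ eb]]] : #|e :\ a| = 2.
  by move: c3; rewrite (cardsD1 a) ae => -[].
exists b, c; rewrite /listed /= -(setD1K ae) eb; apply/eqP/setP => x.
by rewrite !inE.
Qed.

Lemma list_card3_2 (e : {set T}) a b : #|e| = 3 -> a \in e -> b \in e -> a != b ->
  exists c, listed e [:: a; b; c].
Proof.
move=> c3 ae be ab; have [c [d /andP[_ /eqP ed]]] := list_card3 c3 ae.
move: be; rewrite ed !inE eq_sym (negbTE ab) /= => /orP[/eqP->|/eqP->].
- by exists d; rewrite /listed !eqxx.
- exists c; rewrite /listed eqxx andTb; apply/eqP/setP => x; rewrite !inE.
  by case: (x == a); case: (x == c); case: (x == d).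
Qed.

(** The two rich pairs would replace the single edge [e]. *)
Lemma rich_uncovered_disjoint e a a' x x' : e \in M -> a \in e -> a' \in e ->
  a != a' -> x \in X -> x' \in X -> x != x' -> rich a x -> rich a' x' -> False.
Proof.
move=> eM ae ae' aa' xX xX' xx' rax rax'.
have [c ec] := list_card3_2 (M3 eM) ae ae' aa'.
have notX v y : v \in e -> y \in X -> v != y.
  move=> ve; rewrite mem_X; apply: contraNneq => <-.
  by apply/bigcupP; exists e.
have := @no_augmentation_seq [:: (e, [:: a; a'; c])] [::] [:: (a, x); (a', x')].
rewrite /= eM ec rax rax' xX xX' !inE !eqxx ?orbT ?negb_or /= aa' xx'.
rewrite [x == a']eq_sym !notX //.
by move/(_ isT isT nil_edges isT isT isT isT isT).
Qed.

(** The three rich pairs would replace the two edges. *)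
Lemma no_rich_perfect_matching e f a1 a2 a3 b1 b2 b3 : e \in M -> f \in M -> e != f ->
  listed e [:: a1; a2; a3] -> listed f [:: b1; b2; b3] ->
  rich a1 b1 -> rich a2 b2 -> rich a3 b3 -> False.
Proof.
move=> eM fM ef el fl r1 r2 r3.
pose L := [:: (e, [:: a1; a2; a3]); (f, [:: b1; b2; b3])].
have LM : all (fun p => (p.1 \in M) && listed p.1 p.2) L by rewrite /= eM fM el fl.
have uL : uniq [seq p.1 | p <- L] by rewrite /= inE ef.
have := @no_augmentation_seq L [::] [:: (a1, b1); (a2, b2); (a3, b3)] LM uL.
move/(_ nil_edges isT); rewrite /= r1 r2 r3 => /(_ isT).
move/(_ (uniq_map_nth a1 (I := [:: 0; 3; 1; 4; 2; 5]) (listed_flatten_uniq LM uL) isT isT)).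
by rewrite !inE !eqxx ?orbT => /(_ isT isT).
Qed.

(* K_{2,3} minus one pair: the rows are the first two entries of [s], and the missing
   pair joins the second of them to the last entry of [t]. *)
Definition pattern23 (s t : seq T) :=
  if (s, t) is ([:: a; b; _], [:: x; y; z])
  then [&& rich a x, rich a y, rich a z, rich b x & rich b y] else false.

Lemma no_pattern23_K32 e1 e2 e3 f1 f2 s1 s2 s3 t1 t2 :
    all (fun p => (p.1 \in M) && listed p.1 p.2)
      [:: (e1, s1); (e2, s2); (e3, s3); (f1, t1); (f2, t2)] ->
    uniq [:: e1; e2; e3; f1; f2] ->
    [/\ pattern23 s1 t1, pattern23 s2 t1 & pattern23 s3 t1] ->
    [/\ pattern23 s1 t2, pattern23 s2 t2 & pattern23 s3 t2] -> False.
Proof.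
case: s1 => [|a1 [|b1 [|c1 [|? ?]]]]; try by move=> ? ? [].
case: s2 => [|a2 [|b2 [|c2 [|? ?]]]]; try by move=> ? ? [].
case: s3 => [|a3 [|b3 [|c3 [|? ?]]]]; try by move=> ? ? [].
case: t1 => [|x1 [|y1 [|z1 [|? ?]]]]; try by move=> ? ? [].
case: t2 => [|x2 [|y2 [|z2 [|? ?]]]]; try by move=> ? ? ? [].
set L := (X in all _ X) => LM uL.
(* Six rich pairs replace five edges: they use up both [f]'s, and two vertices of each [e]. *)
case=> /and5P[? ? ? ? ?] /and5P[? ? ? ? ?] /and5P[? ? ? ? ?].
case=> /and5P[? ? ? ? ?] /and5P[? ? ? ? ?] /and5P[? ? ? ? ?].
have := @no_augmentation_seq L [::]
  [:: (b1, x1); (b2, y1); (b3, x2); (a1, z1); (a2, z2); (a3, y2)] LM uL.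
move/(_ nil_edges isT); rewrite [X in is_true X -> _]/=.
have -> : [&& rich b1 x1, rich b2 y1, rich b3 x2, rich a1 z1, rich a2 z2, rich a3 y2 & true].
  by do !(apply/andP; split=> //).
move/(_ isT (uniq_map_nth a1 (I := [:: 1; 9; 4; 10; 7; 12; 0; 11; 3; 14; 6; 13])
   (listed_flatten_uniq LM uL) isT isT)).
by rewrite /= !inE !eqxx ?orbT => /(_ isT isT).
Qed.

Definition star a (f : {set T}) := [forall b in f, rich a b].

Lemma starP a f b : star a f -> b \in f -> rich a b.
Proof. by move/forall_inP; apply. Qed.

(** If [a] and [a'] differ, four rich pairs replace the three edges. Which four depends on whether
    [f] has the same centre towards [e] and [g]. *)
Lemma star_center_unique e f g a b a' c d :
    e \in M -> f \in M -> g \in M -> uniq [:: e; f; g] ->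
    a \in e -> b \in f -> star a f -> star b e ->
    a' \in e -> c \in g -> star a' g -> star c e ->
    d \in f -> star d g -> a = a'.
Proof.
move=> eM fM gM uefg ae bf af be ae' cg ag ce df dg.
apply/eqP/negP => /negP aa'.
have [a3 el] := list_card3_2 (M3 eM) ae ae' aa'.
have [g2 [g3 gl]] := list_card3 (M3 gM) cg.
have ine x : x \in [:: a; a'; a3] -> x \in e by rewrite (listed_mem el).
have ing x : x \in [:: c; g2; g3] -> x \in g by rewrite (listed_mem gl).
(* One centre [b] in [f]: it is paired with a vertex of [g], and the third vertex of [e] goes to
   [c]. *)
case: (eqVneq b d) => bd.
- rewrite -bd in dg; have [f2 [f3 fl]] := list_card3 (M3 fM) bf.
  have inf x : x \in [:: b; f2; f3] -> x \in f by rewrite (listed_mem fl).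
  pose L := [:: (e, [:: a; a'; a3]); (f, [:: b; f2; f3]); (g, [:: c; g2; g3])].
  have LM : all (fun p => (p.1 \in M) && listed p.1 p.2) L.
    by rewrite /= eM fM gM el fl gl.
  have := @no_augmentation_seq L [::] [:: (a, f2); (a', g2); (b, g3); (c, a3)] LM uefg.
  move/(_ nil_edges isT); rewrite [X in is_true X -> _]/=.
  rewrite (starP af) ?(starP ag) ?(starP dg) ?(starP ce);
    try by (apply: ine || apply: inf || apply: ing); rewrite !inE eqxx ?orbT.
  move/(_ isT (uniq_map_nth a (I := [:: 0; 4; 1; 7; 3; 8; 6; 2])
     (listed_flatten_uniq LM uefg) isT isT)).
  by rewrite /= !inE !eqxx ?orbT => /(_ isT isT).
(* Two centres in [f]: [b] takes the third vertex of [e], and [d] a vertex of [g]. *)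
- have [f3 fl] := list_card3_2 (M3 fM) bf df bd.
  have inf x : x \in [:: b; d; f3] -> x \in f by rewrite (listed_mem fl).
  pose L := [:: (e, [:: a; a'; a3]); (f, [:: b; d; f3]); (g, [:: c; g2; g3])].
  have LM : all (fun p => (p.1 \in M) && listed p.1 p.2) L.
    by rewrite /= eM fM gM el fl gl.
  have := @no_augmentation_seq L [::] [:: (a, f3); (b, a3); (a', g2); (d, g3)] LM uefg.
  move/(_ nil_edges isT); rewrite [X in is_true X -> _]/=.
  rewrite (starP af) ?(starP ag) ?(starP dg) ?(starP be);
    try by (apply: ine || apply: inf || apply: ing); rewrite !inE eqxx ?orbT.
  move/(_ isT (uniq_map_nth a (I := [:: 0; 5; 3; 2; 1; 7; 4; 8])
     (listed_flatten_uniq LM uefg) isT isT)).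
  by rewrite /= !inE !eqxx ?orbT => /(_ isT isT).
Qed.

(** Cyclically, each centre is paired with the vertex of the next edge that is neither the centre
    there nor on the hypothetical edge. These three pairs and that edge would replace three
    edges. *)
Lemma no_edge_avoiding_centers e f g a1 a2 a3 b1 b2 b3 :
    e \in M -> f \in M -> g \in M -> uniq [:: e; f; g] ->
    a1 \in e -> a2 \in f -> a3 \in g -> b1 \in e -> b2 \in f -> b3 \in g ->
    a1 != b1 -> a2 != b2 -> a3 != b3 -> star a1 f -> star a2 g -> star a3 e ->
  [set b1; b2; b3] \notin E.
Proof.
move=> eM fM gM uefg a1e a2f a3g b1e b2f b3g ab1 ab2 ab3 s1 s2 s3.
apply/negP => bE.
have [c1 el] := list_card3_2 (M3 eM) a1e b1e ab1.
have [c2 fl] := list_card3_2 (M3 fM) a2f b2f ab2.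
have [c3 gl] := list_card3_2 (M3 gM) a3g b3g ab3.
pose L := [:: (e, [:: a1; b1; c1]); (f, [:: a2; b2; c2]); (g, [:: a3; b3; c3])].
have LM : all (fun p => (p.1 \in M) && listed p.1 p.2) L.
  by rewrite /= eM fM gM el fl gl.
have := @no_augmentation_seq L [:: [:: b1; b2; b3]] [:: (a1, c2); (a2, c3); (a3, c1)] LM uefg.
have QE : {subset [seq [set:: s] | s <- [:: [:: b1; b2; b3]]] <= E}.
  move=> q; rewrite /= inE => /eqP->; congr (_ \in E): bE.
  by apply/setP => x; rewrite !inE orbA.
move/(_ QE isT); rewrite [X in is_true X -> _]/=.
have c1e : c1 \in e by rewrite (listed_mem el) !inE eqxx !orbT.
have c2f : c2 \in f by rewrite (listed_mem fl) !inE eqxx !orbT.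
have c3g : c3 \in g by rewrite (listed_mem gl) !inE eqxx !orbT.
rewrite (starP s1 c2f) (starP s2 c3g) (starP s3 c1e).
move/(_ isT (uniq_map_nth a1 (I := [:: 1; 4; 7; 0; 5; 3; 8; 6; 2])
   (listed_flatten_uniq LM uefg) isT isT)).
by rewrite /= !inE !eqxx ?orbT => /(_ isT isT).
Qed.

(** * Counting the rich pairs *)

Definition relist (v0 : T) (e : {set T}) (s : seq nat) := [seq nth v0 (enum e) i | i <- s].

Lemma enum_listed e : e \in M -> exists a b c, enum e = [:: a; b; c].
Proof.
move=> eM; have := M3 eM; rewrite cardE.
by case: (enum e) => [|a [|b [|c [|? ?]]]] // _; exists a, b, c.
Qed.

Lemma listed_relist v0 e s : e \in M -> s \in perms3 -> listed e (relist v0 e s).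
Proof.
move=> eM; have [a [b [c ee]]] := enum_listed eM.
have xe x : (x \in e) = [|| x == a, x == b | x == c] by rewrite -mem_enum ee !inE.
rewrite /listed /relist ee /perms3 !inE.
do 5?[case/orP]; move/eqP => -> /=; apply/eqP/setP => x; rewrite xe !inE;
  by case: (x == a); case: (x == b); case: (x == c).
Qed.

(** Fixing the positions [p] of the pattern makes every [e] see the same ordering of [f], and
    conversely, as [no_pattern23_K32] requires. *)
Definition twostar v0 (p : seq nat * seq nat) (e f : {set T}) :=
  (e != f) && pattern23 (relist v0 e p.1) (relist v0 f p.2).

Definition twostars v0 e f := has (fun p => twostar v0 p e f) perm_pairs.

(** Three common neighbours of two edges would form the configuration excluded by
    [no_pattern23_K32]. *)
Lemma twostar_sum v0 p : p \in perm_pairs ->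
  (\sum_(e in M) \sum_(f in M) twostar v0 p e f) ^ 2 <= 3 * #|M| ^ 3.
Proof.
case/allpairsP => -[s t] [/= s3 t3 ->]; apply: K32_free_sum => f f' fM f'M ff'.
rewrite leqNgt; apply/negP => c3.
have /card_gt2P[e1 [e2 [e3 [[h1 h2 h3] [n12 n23 n31]]]]] := c3.
move: h1 h2 h3; rewrite !inE => /andP[e1M /andP[/andP[? ?] /andP[? ?]]].
move=> /andP[e2M /andP[/andP[? ?] /andP[? ?]]] /andP[e3M /andP[/andP[? ?] /andP[? ?]]].
apply: (@no_pattern23_K32 e1 e2 e3 f f' (relist v0 e1 s) (relist v0 e2 s)
  (relist v0 e3 s) (relist v0 f t) (relist v0 f' t)) => //.
  by rewrite /= !listed_relist // e1M e2M e3M fM f'M.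
rewrite /= !inE !negb_or n12 n23 ff' [e1 == e3]eq_sym n31 !andbT.
by do !(apply/andP; split=> //).
Qed.

Lemma twostars_sum v0 :
  (\sum_(e in M) \sum_(f in M) twostars v0 e f) ^ 2 <= 36 ^ 2 * (3 * #|M| ^ 3).
Proof.
(* The value 0 outside [perm_pairs] makes the bound hold for every [p], as [sqr_bigsum_max] asks. *)
pose F p := if p \in perm_pairs then \sum_(e in M) \sum_(f in M) twostar v0 p e f else 0.
have FC p : F p ^ 2 <= 3 * #|M| ^ 3.
  by rewrite /F; case: ifP => // pp; exact: twostar_sum.
apply: leq_trans (sqr_bigsum_max perm_pairs FC).
rewrite leq_exp2r // (eq_big_seq (fun p => \sum_(e in M) \sum_(f in M) twostar v0 p e f)).
  rewrite [leqRHS]exchange_big /=; apply: leq_sum => e eM.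
  rewrite [leqRHS]exchange_big /=.
  apply: leq_sum => f fM; rewrite /twostars; elim: perm_pairs => //= p s IH.
  by rewrite big_cons; case: (twostar v0 p e f).
by move=> p pp; rewrite /F pp.
Qed.

Definition linked (e f : {set T}) :=
  (e != f) && [exists a in e, exists b in f, star a f && star b e].

Definition weight (e f : {set T}) := \sum_(a in e) \sum_(b in f) rich a b.

(** An exceptional pair has weight at most 9, and [9 + 1 = 5 + 5]; weight at most 4 leaves room for
    the 1 charged to an unlinked pair. *)
Lemma weight_arith (w : nat) (l t1 t2 d : bool) :
  (w <= 9) && [|| t1, t2 | d] || (w <= 4) || l && (w <= 5) ->
  w + ~~ l <= 5 + 5 * t1 + 5 * t2 + 5 * d.
Proof. by case: l; case: t1; case: t2; case: d => /=; lia. Qed.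

(** [matrix3_cases] for the matrix of rich pairs. The term charged to unlinked pairs later turns a
    nearly optimal count into structure. *)
Lemma weight_bound v0 e f : e \in M -> f \in M ->
  weight e f + ~~ linked e f <=
    5 + 5 * twostars v0 e f + 5 * twostars v0 f e + 5 * (e == f).
Proof.
move=> eM fM.
pose r i j := rich (nth v0 (enum e) i) (nth v0 (enum f) j).
have [a1 [a2 [a3 ee]]] := enum_listed eM.
have [b1 [b2 [b3 ef]]] := enum_listed fM.
have wE : weight e f = weight3 r.
  rewrite /weight /weight3 /r ee ef /= -big_enum /= ee !big_cons big_nil /=.
  by rewrite -!big_enum /= ef !big_cons !big_nil !addn0 !addnA.
have w9 : weight3 r <= 9.
  by rewrite /weight3; do 9!case: (r _ _).
rewrite wE; apply: weight_arith; case: (eqVneq e f) => [ef'|nef].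
  by rewrite w9 !orbT.
have lM g : g \in M -> listed g (enum g).
  move=> gM; rewrite /listed -cardE (M3 gM) eqxx /=; apply/eqP/setP => x.
  by rewrite inE mem_enum.
(* For each of the 36 pairs of orders, [pattern23] computes to the condition inside
   [has_pattern23]. *)
have pat s t g h : s \in perms3 -> t \in perms3 ->
    pattern23 (relist v0 g s) (relist v0 h t) =
    (let q i j := rich (nth v0 (enum g) i) (nth v0 (enum h) j) in
     [&& q (nth 0 s 0) (nth 0 t 0), q (nth 0 s 0) (nth 0 t 1), q (nth 0 s 0) (nth 0 t 2),
        q (nth 0 s 1) (nth 0 t 0) & q (nth 0 s 1) (nth 0 t 1)]).
  by rewrite /perms3 !inE; do 5?[case/orP]; move/eqP->; do 5?[case/orP]; move/eqP->.
case/or4P: (matrix3_cases r).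
- case/hasP => s s3 /and3P[r0 r1 r2]; exfalso.
  have := listed_relist v0 fM s3; rewrite /relist.
  have : size s = 3 by move: s3; rewrite /perms3 !inE; do 5?[case/orP]; move/eqP->.
  case: s s3 r0 r1 r2 => [|i [|j [|k [|? ?]]]] //= s3 r0 r1 r2 _ fl.
  move: r0 r1 r2; rewrite /r ee /=; apply: (no_rich_perfect_matching eM fM nef) fl.
  by rewrite -ee lM.
- case/hasP => -[s t] st h.
  have -> : twostars v0 e f.
    apply/hasP; exists (s, t) => //; rewrite /twostar nef /=.
    by case/allpairsP: st => -[s' t'] [/= s3 t3 [? ?]]; subst s' t'; rewrite pat.
  by rewrite w9 ?orbT.
- case/hasP => -[s t] st h.
  have -> : twostars v0 f e.
    apply/hasP; exists (s, t) => //; rewrite /twostar eq_sym nef /=.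
    case/allpairsP: st => -[s' t'] [/= s3 t3 [? ?]]; subst s' t'; rewrite pat //=.
    by rewrite /= /r in h; rewrite !(richC (nth v0 (enum f) _)).
  by rewrite w9 ?orbT.
- case/orP => [w4|/andP[/hasP[i i3 /hasP[j j3 /allP ij]] w5]].
    by rewrite w4 orbT.
  have ni k : k \in iota 0 3 -> k < 3 by rewrite mem_iota.
  have inn g k : g \in M -> k < 3 -> nth v0 (enum g) k \in g.
    by move=> gM k3; rewrite -mem_enum mem_nth // -cardE (M3 gM).
  have idx g x : g \in M -> x \in g -> exists2 k, k \in iota 0 3 & x = nth v0 (enum g) k.
    move=> gM; rewrite -mem_enum => xg; exists (index x (enum g)); last by rewrite nth_index.
    by rewrite mem_iota /= -(M3 gM) cardE index_mem.
  have -> : linked e f.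
    rewrite /linked nef; apply/exists_inP; exists (nth v0 (enum e) i); first exact/inn/ni.
    apply/exists_inP; exists (nth v0 (enum f) j); first exact/inn/ni.
    apply/andP; split; apply/forall_inP => x.
      by case/(idx _ _ fM) => k /ij/andP[rik _] ->.
    by case/(idx _ _ eM) => k /ij/andP[_ rkj] ->; rewrite richC.
  by rewrite w5 !orbT.
Qed.

(** If some vertex of [e] has two rich partners in [X], the other two have none, by
    [rich_uncovered_disjoint]; otherwise each of the three has at most one. *)
Lemma rich_uncovered_sum e : e \in M ->
  \sum_(a in e) \sum_(x in X) rich a x <= #|X| + 3.
Proof.
move=> eM; pose N a := [set x in X | rich a x].
have dE a : \sum_(x in X) rich a x = #|N a|.
  rewrite -sum1_card [RHS](eq_bigl (fun x => (x \in X) && rich a x)).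
    by rewrite [RHS]big_mkcondr; apply: eq_bigr => x _; case: ifP.
  by move=> x; exact: in_set.
under eq_bigr do rewrite dE.
have NX a : #|N a| <= #|X| by apply/subset_leq_card/subsetP => x /setIdP[].
have [/exists_inP[a ae a1]|] := boolP [exists a in e, 1 < #|N a|].
  rewrite (bigD1 a) //= big1 ?addn0; first by apply: leq_trans (NX a) (leq_addr _ _).
  move=> a' /andP[ae' aa']; apply/eqP; rewrite cards_eq0; apply/eqP/setP => y.
  rewrite [RHS]inE; apply/negP => /setIdP[yX ray].
  have /card_gt1P[x [x' [/setIdP[xX rx] /setIdP[xX' rx'] xx']]] := a1.
  rewrite eq_sym in aa'.
  (* One of the two partners [x], [x'] of [a] differs from the partner [y] of [a']. *)
  have [xy|xy] := eqVneq x y.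
    by apply: (@rich_uncovered_disjoint e a a' x' y) => //; rewrite -xy eq_sym.
  by apply: (@rich_uncovered_disjoint e a a' x y).
rewrite negb_exists_in => /forall_inP small.
apply: leq_trans (leq_addl _ _); rewrite -(M3 eM) -sum1_card.
by apply: leq_sum => a /small; rewrite -leqNgt.
Qed.

Lemma sum_cover (F : T -> nat) :
  \sum_a F a = \sum_(e in M) \sum_(a in e) F a + \sum_(x in X) F x.
Proof.
rewrite (bigID (mem (cover M))) /= -(big_trivIset _ triM) /=; congr (_ + _).
by apply: eq_bigl => x; rewrite mem_X.
Qed.

Definition richsum := \sum_a \sum_b rich a b.
Definition unlinked := \sum_(e in M) \sum_(f in M) ~~ linked e f.

(** Pairs within [X] are never rich, mixed pairs count twice, and pairs within [cover M] fall under
    [weight_bound], summed over all ordered pairs of edges with the diagonal included. *)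
Lemma richsum_bound v0 :
  richsum + unlinked <= 2 * (#|M| * (#|X| + 3)) + 5 * #|M| ^ 2 + 5 * #|M|
    + 10 * \sum_(e in M) \sum_(f in M) twostars v0 e f.
Proof.
set t := \sum_(e in M) _.
have MX : \sum_(e in M) \sum_(a in e) \sum_(x in X) rich a x <= #|M| * (#|X| + 3).
  by rewrite -sum_nat_const; apply: leq_sum => e eM; exact: rich_uncovered_sum.
have MM : \sum_(e in M) \sum_(f in M) weight e f + unlinked <= 5 * #|M| ^ 2 + 5 * #|M| + 10 * t.
  rewrite /unlinked -big_split /=.
  apply: (@leq_trans (\sum_(e in M) \sum_(f in M)
     (5 + 5 * twostars v0 e f + 5 * twostars v0 f e + 5 * (e == f)))).
    apply: leq_sum => e eM; rewrite -big_split /=; apply: leq_sum => f fM.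
    exact: weight_bound.
  rewrite (eq_bigr (fun e => 5 * #|M| + 5 * (\sum_(f in M) twostars v0 e f) +
     5 * (\sum_(f in M) twostars v0 f e) + 5 * 1)).
    rewrite !big_split /= !sum_nat_const.
    rewrite [\sum_(e in M) \sum_(f in M) twostars v0 f e]exchange_big /= -/t.
    by rewrite expnS expn1; move: (#|M|) t => m t; lia.
  move=> e eM; have e1 : \sum_(f in M) (e == f) = 1.
    rewrite (bigD1 e) //= eqxx big1 // => f /andP[_].
    by rewrite eq_sym => /negbTE->.
  rewrite !big_split /= !sum_nat_const e1.
  by move: (\sum_(f in M) _) (\sum_(f in M) _) (#|M|) => x y m; lia.
have -> : richsum = \sum_(e in M) \sum_(f in M) weight e f
    + 2 * \sum_(e in M) \sum_(a in e) \sum_(x in X) rich a x.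
  rewrite /richsum sum_cover.
  rewrite [X in _ + X = _](_ : _ = \sum_(e in M) \sum_(a in e) \sum_(x in X) rich a x).
    rewrite mul2n -addnn addnA; congr (_ + _); rewrite -big_split /=.
    apply: eq_bigr => e eM; under eq_bigr do rewrite sum_cover.
    by rewrite big_split /= exchange_big.
  under eq_bigr do rewrite sum_cover.
  rewrite big_split /= [X in _ + X](_ : _ = 0) ?addn0.
    rewrite exchange_big /=; apply: eq_bigr => e eM; rewrite exchange_big /=.
    by apply: eq_bigr => a _; apply: eq_bigr => x _; rewrite richC.
  rewrite big1 // => x xX; rewrite big1 // => y yX.
  by rewrite (negbTE (not_rich_uncovered xX yX)).
by rewrite mulnDr; move: MX MM; rewrite /richsum; lia.
Qed.

(** * Degrees of the uncovered vertices *)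

Lemma degree_pairs x :
  2 * #|[set e in E | x \in e]| <= \sum_a \sum_b ([set a; b; x] \in E).
Proof.
rewrite pair_bigA /= -sum1_card big_distrr /=.
rewrite [leqRHS](_ : _ = \sum_(p : T * T | [set p.1; p.2; x] \in E) 1); last first.
  by rewrite [RHS]big_mkcond; apply: eq_bigr => p _; case: ifP.
rewrite (partition_big (fun p : T * T => [set p.1; p.2; x]) (mem [set e in E | x \in e])) /=.
  apply: leq_sum => e /setIdP[eE xe].
  have [b [c /andP[_ /eqP el]]] := list_card3 (E3 eE) xe.
  have e1 : [set b; c; x] = e by rewrite el; apply/setP => y; rewrite !inE orbC.
  have e2 : [set c; b; x] = e by rewrite -e1 (setUC [set b]).
  have bc : b != c.
    by apply/eqP => bc; have := E3 eE; rewrite -e1 bc setUid cards2; case: eqP.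
  (* An edge at [x] arises from both orders of its other two vertices. *)
  rewrite sum1_card muln1; apply: (@leq_trans #|[set (b, c); (c, b)]|).
    by rewrite cards2 xpair_eqE negb_and bc.
  apply/subset_leq_card/subsetP => p; rewrite !inE => /orP[]/eqP->; rewrite unfold_in /=.
    by rewrite e1 eE eqxx.
  by rewrite e2 eE eqxx.
by move=> p pE; rewrite !inE pE eqxx !orbT.
Qed.

(** A rich pair extends by at most [#|X|] vertices of [X], any other pair by fewer than 18. *)
Lemma uncovered_degree_sum :
  \sum_(x in X) 2 * #|[set e in E | x \in e]| <= #|X| * richsum + 18 * #|T| ^ 2.
Proof.
apply: (@leq_trans (\sum_a \sum_b (#|X| * rich a b + 18))).
  apply: (@leq_trans (\sum_(x in X) \sum_a \sum_b ([set a; b; x] \in E))).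
    by apply: leq_sum => x _; exact: degree_pairs.
  rewrite exchange_big /=; apply: leq_sum => a _; rewrite exchange_big /=.
  apply: leq_sum => b _; rewrite (_ : \sum_(x in X) _ = #|[set x in X | [set a; b; x] \in E]|).
    case: (boolP (rich a b)); rewrite /rich.
      move=> _; rewrite muln1; apply: leq_trans (leq_addr _ _).
      by apply/subset_leq_card/subsetP => x /setIdP[].
    by rewrite -ltnNge muln0 => /ltnW.
  rewrite -sum1_card [RHS](eq_bigl (fun x => (x \in X) && ([set a; b; x] \in E))).
    by rewrite [RHS]big_mkcondr; apply: eq_bigr => x _; case: ifP.
  by move=> x; exact: in_set.
under eq_bigr do rewrite big_split /= -big_distrr /= sum_nat_const.
rewrite big_split /= -big_distrr /= sum_nat_const /richsum leq_add2l.
by rewrite mulnA mulnC.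
Qed.

(** * Centres of linked edges and the sparse set *)

Lemma linked_center e f f0 a b0 d : e \in M -> f \in M -> f0 \in M ->
    linked e f -> linked e f0 -> linked f f0 ->
    a \in e -> star a f0 -> b0 \in f0 -> star b0 e -> d \in f -> star d f0 ->
  star a f.
Proof.
move=> eM fM f0M ef ef0 ff0 ae af0 b0f0 b0e df df0.
have [nef /exists_inP[a1 a1e /exists_inP[b1 b1f /andP[a1f b1e]]]] := andP ef.
(* Uniqueness of the centre in the triangle [e], [f], [f0] identifies the centre towards [f] with
   the one towards [f0]. *)
suff <- : a1 = a by [].
apply: (@star_center_unique e f f0 a1 b1 a b0 d) => //.
by rewrite /= !inE negb_or nef; case/andP: ef0 => -> _; case/andP: ff0 => ->.
Qed.

(** The minimum is at most the average. *)
Lemma exists_low_unlinked : 0 < #|M| ->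
  exists2 f0, f0 \in M & #|M| * \sum_(e in M) ~~ linked e f0 <= unlinked.
Proof.
case/card_gt0P => f1 f1M; pose k f := \sum_(e in M) ~~ linked e f.
exists [arg min_(f < f1 | f \in M) k f]; first by case: arg_minnP.
case: arg_minnP => // f0 f0M min.
rewrite /unlinked exchange_big /= -sum_nat_const; exact: leq_sum.
Qed.

(** A reference edge [f0] with few unlinked partners selects a centre in every edge linked to it;
    [B] is the complement of the selected vertices. Each edge inside [B] contains a bad pair, and
    bad pairs are few. *)
Lemma sparse_complement_of_centers : 0 < #|M| ->
  exists (B : {set T}) (k : nat),
    [/\ #|T| <= #|B| + #|M|, #|M| * k <= unlinked &
        #|[set h in E | h \subset B]| <=
          #|T| * (2 * (#|T| * (#|X| + 3 * k)) + 9 * unlinked)].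
Proof.
move=> M0; have [f0 f0M kM] := exists_low_unlinked M0.
set k := \sum_(e in M) _ in kM.
have [v0 _] : exists v0, v0 \in f0 by apply/card_gt0P; rewrite M3.
pose c (e : {set T}) := odflt v0 [pick a in e | star a f0].
have cP e : linked e f0 -> [/\ c e \in e, star (c e) f0 & exists2 b, b \in f0 & star b e].
  case/andP => _ /exists_inP[a ae /exists_inP[b bf /andP[af be]]].
  rewrite /c; case: pickP => [a' /andP[ae' af']|/(_ a)]; last by rewrite /= ae af.
  by split=> //; exists b.
(* [U] contains [f0] itself, as [linked] holds only for distinct edges. *)
pose U := [set e in M | ~~ linked e f0].
pose Z := X :|: cover U.
pose B := ~: [set c e | e in M].
have kU : k = #|U|.
  rewrite /k -sum1_card [RHS](eq_bigl (fun e => (e \in M) && ~~ linked e f0)).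
    by rewrite [RHS]big_mkcondr; apply: eq_bigr => e _; case: (linked _ _).
  by move=> e; exact: in_set.
have cZ : #|Z| <= #|X| + 3 * k.
  apply: leq_trans (leq_card_setU _ _) _; rewrite leq_add2l kU.
  apply: leq_trans (leq_card_cover _) _; rewrite mulnC -sum_nat_const.
  by apply: leq_sum => e /setIdP[eM _]; rewrite M3.
have notZ v : v \notin Z ->
    [/\ v \in pblock M v, pblock M v \in M & linked (pblock M v) f0].
  rewrite in_setU negb_or mem_X negbK => /andP[vM vU].
  have vp : v \in pblock M v by rewrite mem_pblock.
  have pM : pblock M v \in M by rewrite pblock_mem.
  split=> //; apply: contraNT vU => nl; apply/bigcupP; exists (pblock M v) => //.
  by rewrite inE pM.
pose bad (a b : T) := [|| a \in Z, b \in Z | ~~ linked (pblock M a) (pblock M b)].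
have center v : v \in B -> v \notin Z -> c (pblock M v) != v.
  move=> vB vZ; have [_ pM _] := notZ v vZ; apply: contraTneq vB => <-.
  by rewrite inE negbK; apply/imsetP; exists (pblock M v).
(* The centre towards [f0] also serves every linked edge that is itself linked to [f0], by
   [linked_center]. *)
have starc u v : ~~ bad u v -> star (c (pblock M u)) (pblock M v).
  rewrite !negb_or negbK => /and3P[/notZ[_ uM ul] /notZ[_ vM vl] uv].
  have [cu su [b bf bu]] := cP _ ul; have [cv sv _] := cP _ vl.
  exact: (linked_center uM vM f0M uv ul vl cu su bf bu cv sv).
(* The three pairs run cyclically, like the stars in [no_edge_avoiding_centers]. *)
have noedge a b d : [set a; b; d] \in E -> [set a; b; d] \subset B ->
    [|| bad a b, bad b d | bad d a].
  move=> hE hB; case: (boolP (bad a b)) => //= ab; case: (boolP (bad b d)) => //= bd.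
  apply/negPn/negP => da.
  have [aB bB dB] : [/\ a \in B, b \in B & d \in B].
    by split; apply: (subsetP hB); rewrite !inE eqxx ?orbT.
  have s1 := starc _ _ ab; have s2 := starc _ _ bd; have s3 := starc _ _ da.
  move: ab bd da; rewrite /bad !negb_or !negbK.
  move=> /and3P[aZ bZ lab] /and3P[_ dZ lbd] /and3P[_ _ lda].
  have [ap aM al] := notZ _ aZ; have [bp bM bl] := notZ _ bZ.
  have [dp dM dl] := notZ _ dZ.
  have [ca _ _] := cP _ al; have [cb _ _] := cP _ bl; have [cd _ _] := cP _ dl.
  have u3 : uniq [:: pblock M a; pblock M b; pblock M d].
    rewrite /= !inE negb_or; case/andP: lab => -> _; case/andP: lbd => -> _.
    by rewrite eq_sym; case/andP: lda => ->.
  have /negP := no_edge_avoiding_centers aM bM dM u3 ca cb cd ap bp dp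
    (center _ aB aZ) (center _ bB bZ) (center _ dB dZ) s1 s2 s3.
  by apply.
have cbad : \sum_a \sum_b bad a b <= 2 * (#|T| * (#|X| + 3 * k)) + 9 * unlinked.
  pose g (a b : T) : nat :=
    [&& a \in cover M, b \in cover M & ~~ linked (pblock M a) (pblock M b)].
  apply: (@leq_trans (\sum_a \sum_b ((a \in Z) + (b \in Z) + g a b))).
    do 2!apply: leq_sum => ? _; rewrite /bad /g.
    case: (boolP (_ \in Z)) => [//|/notZ[+ _ _]]; rewrite mem_pblock => -> /=.
    by case: (boolP (_ \in Z)) => [//|/notZ[+ _ _]]; rewrite mem_pblock => -> /=.
  have sZ : \sum_(v : T) (v \in Z) = #|Z|.
    by rewrite -sum1_card [RHS]big_mkcond; apply: eq_bigr => v _; case: ifP.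
  (* Each ordered pair of edges accounts for 3 times 3 pairs of vertices. *)
  have sg : \sum_a \sum_b g a b = 9 * unlinked.
    rewrite /unlinked big_distrr sum_cover /= [X in _ + X = _]big1 ?addn0; last first.
      by move=> x; rewrite mem_X => xM; rewrite big1 // => y _; rewrite /g (negbTE xM).
    apply: eq_bigr => e eM; rewrite big_distrr.
    transitivity (\sum_(a in e) \sum_(f in M) 3 * ~~ linked e f).
      apply: eq_bigr => a ae.
      have aM : a \in cover M by apply/bigcupP; exists e.
      rewrite sum_cover [X in _ + X = _]big1 ?addn0; last first.
        by move=> x; rewrite mem_X => xM; rewrite /g (negbTE xM) !andbF.
      apply: eq_bigr => f fM; rewrite -(M3 fM) -sum_nat_const.
      apply: eq_bigr => b bf; have bM : b \in cover M by apply/bigcupP; exists f.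
      by rewrite /g aM bM (def_pblock triM eM ae) (def_pblock triM fM bf).
    rewrite sum_nat_const (M3 eM) big_distrr /=.
    by apply: eq_bigr => f _; rewrite mulnA.
  under eq_bigr do rewrite big_split big_split /= sum_nat_const sZ.
  rewrite big_split big_split /= sg sum_nat_const -big_distrr /= sZ.
  have Tle : #|{: T}| * #|Z| <= #|T| * (#|X| + 3 * k) by rewrite leq_mul2l cZ orbT.
  by rewrite leq_add2r mul2n -addnn leq_add.
exists B, k; split=> //.
  rewrite /B -(cardsC [set c e | e in M]) addnC leq_add2l; exact: leq_imset_card.
apply: leq_trans (leq_mul (leqnn _) cbad).
(* Rotating an edge inside [B] puts its bad pair first, so it is the image of a triple in [D]. *)
pose D := [set p : T * T * T | bad p.1.1 p.1.2].
have -> : #|T| * \sum_a \sum_b bad a b = #|D|.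
  have -> : D = setX [set q | bad q.1 q.2] setT.
    by apply/setP => p; rewrite !inE andbT.
  rewrite cardsX cardsT mulnC; congr (_ * _); rewrite pair_bigA /= -sum1_card.
  by rewrite [RHS]big_mkcond; apply: eq_bigr => q _; rewrite inE; case: (bad _ _).
apply: leq_trans (leq_imset_card (fun p : T * T * T => [set p.1.1; p.1.2; p.2]) D).
apply/subset_leq_card/subsetP => h /setIdP[hE hB].
have [a ah] : exists a, a \in h by apply/card_gt0P; rewrite E3.
have [b [d /andP[_ /eqP hl]]] := list_card3 (E3 hE) ah.
have h1 : h = [set a; b; d] by rewrite hl; apply/setP => x; rewrite !inE orbA.
have h2 : h = [set b; d; a] by rewrite hl; apply/setP => x; rewrite !inE orbC.
have h3 : h = [set d; a; b] by rewrite h2; apply/setP => x; rewrite !inE -orbA orbC.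
have := noedge a b d; rewrite -h1 => /(_ hE hB) /or3P[] bd; apply/imsetP.
- by exists (a, b, d); rewrite ?inE.
- by exists (b, d, a); rewrite ?inE.
- by exists (d, a, b); rewrite ?inE.
Qed.

Lemma card_cover_split : #|T| = 3 * #|M| + #|X|.
Proof.
rewrite -(cardsC (cover M)) -/X -(eqP triM); congr (_ + _).
rewrite (eq_bigr (fun=> 3)); first by rewrite sum_nat_const mulnC.
by move=> e; exact: M3.
Qed.

End MaximumMatching.

Lemma exists_maximum_matching (T : finType) (E : {set {set T}}) :
  exists M : {set {set T}}, [/\ M \subset E, trivIset M &
    forall N : {set {set T}}, N \subset E -> trivIset N -> (#|N| <= #|M|)%N].
Proof.
have P0 : ((set0 : {set {set T}}) \subset E) && trivIset (set0 : {set {set T}}).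
  by rewrite sub0set; apply/trivIsetP => A; rewrite inE.
pose P (N : {set {set T}}) := (N \subset E) && trivIset N.
case: (@arg_maxnP _ set0 P (fun N => #|N|) P0) => M /andP[ME tM] maxM.
by exists M; split=> // N NE tN; apply: maxM; rewrite /P NE.
Qed.

(** * Numerical estimates *)

Section Estimates.
Variable R : realType.
Implicit Types n m r b t k eta alpha : R.

(** The variables stand for [#|T|], [#|M|], [#|X|], [richsum], [unlinked] and the sum of [twostars];
    [3888 = 36 ^ 2 * 3]. Three errors of at most [eta * n ^+ 2 / 4] each raise the 10 of the degree
    condition to 11. *)
Lemma deficiency_estimate n m r N b t eta :
    0 < eta -> eta <= 1 / 200%:R -> 10%:R ^+ 6 <= eta ^+ 3 * n ->
    0 <= m -> 0 <= t -> n = 3%:R * m + r -> eta ^+ 2 * n <= r ->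
    r * ((5%:R / 9%:R - 10%:R * eta) * (n * (n - 1))) <= r * N + 18%:R * n ^+ 2 ->
    N + b <= 2%:R * (m * (r + 3%:R)) + 5%:R * m ^+ 2 + 5%:R * m + 10%:R * t ->
    t ^+ 2 <= 3888%:R * m ^+ 3 ->
  b + 4%:R / 9%:R * (n * r) <= 11%:R * eta * n ^+ 2.
Proof.
move=> e0 e1 nbig m0 t0 nE rbig degN Nb tm.
have n0 : 0 < n.
  have e3 : 0 < eta ^+ 3 by rewrite exprn_gt0.
  by rewrite -(pmulr_rgt0 _ e3); apply: lt_le_trans nbig; rewrite exprn_gt0.
have r0 : 0 < r by apply: lt_le_trans rbig; rewrite mulr_gt0 ?exprn_gt0.
have e23 : eta ^+ 3 <= eta ^+ 2.
  by rewrite exprS ler_piMl ?exprn_ge0 ?(ltW e0) //; lra.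
have e12 : eta ^+ 2 <= eta by rewrite expr2 ler_piMl ?(ltW e0) //; lra.
have e2n : 10%:R ^+ 6 <= eta ^+ 2 * n.
  by apply: le_trans nbig _; exact: (ler_wpM2r (ltW n0) e23).
have en : 10%:R ^+ 6 <= eta * n.
  by apply: le_trans e2n _; exact: (ler_wpM2r (ltW n0) e12).
have n2 : 0 < n ^+ 2 by rewrite exprn_gt0.
have en4 : 0 <= eta * n ^+ 2 / 4%:R.
  by have := mulr_gt0 e0 n2; lra.
have lin : 5%:R * n <= eta * n ^+ 2 / 4%:R.
  have := ler_wpM2r (ltW n0) en.
  by rewrite expr2; lra.
(* After division by [r], the term [18 n^2 / r] is small because [r >= eta^2 n] and
   [eta^3 n >= 72]. *)
have degN' : (5%:R / 9%:R - 10%:R * eta) * (n * (n - 1)) <= N + eta * n ^+ 2 / 4%:R.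
  rewrite -(ler_pM2l r0) [leRHS]mulrDr; apply: le_trans degN _; rewrite lerD2l.
  apply: (@le_trans _ _ (eta ^+ 2 * n * (eta * n ^+ 2 / 4%:R))); last first.
    exact: ler_wpM2r rbig.
  rewrite [leRHS](_ : _ = (eta ^+ 3 * n / 4%:R) * n ^+ 2); last by field.
  by apply: ler_wpM2r; [exact: ltW | lra].
have mn : 3%:R * m <= n by rewrite nE lerDl ltW.
(* The bound on [t] has order n^{3/2}; squares are compared to avoid roots. *)
have t' : 10%:R * t <= eta * n ^+ 2 / 4%:R.
  have m3 : (3%:R * m) ^+ 3 <= n ^+ 3 by rewrite lerXn2r ?nnegrE ?mulr_ge0 ?(ltW n0).
  have p3 : 0 <= n ^+ 3 by rewrite exprn_ge0 // ltW.
  have n4 := ler_wpM2r p3 e2n.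
  have : (10%:R * t) ^+ 2 <= (eta * n ^+ 2 / 4%:R) ^+ 2.
    have e4 : eta ^+ 2 * n * n ^+ 3 = 16%:R * (eta * n ^+ 2 / 4%:R) ^+ 2 by field.
    have m3' : (3%:R * m) ^+ 3 = 27%:R * m ^+ 3 by ring.
    have t2 : (10%:R * t) ^+ 2 = 100%:R * t ^+ 2 by ring.
    rewrite t2; rewrite e4 in n4; rewrite m3' in m3; lra.
  by rewrite ler_pXn2r // nnegrE ?mulr_ge0 ?en4.
(* With [m = (n - r) / 3] the two sides differ by exactly [r ^+ 2 / 9]. *)
have main : 2%:R * (m * r) + 5%:R * m ^+ 2 <= 5%:R / 9%:R * n ^+ 2 - 4%:R / 9%:R * (n * r).
  have -> : m = (n - r) / 3%:R by rewrite nE; field.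
  rewrite -subr_ge0 (_ : _ - _ = r ^+ 2 / 9%:R); last by field.
  by rewrite divr_ge0 // exprn_ge0 // ltW.
have en0 : 0 < eta * n by rewrite mulr_gt0.
have degN2 : (5%:R / 9%:R - 10%:R * eta) * (n * (n - 1)) =
  5%:R / 9%:R * n ^+ 2 - 10%:R * eta * n ^+ 2 - 5%:R / 9%:R * n + 10%:R * (eta * n) by field.
have Nb2 : 2%:R * (m * (r + 3%:R)) = 2%:R * (m * r) + 6%:R * m by ring.
rewrite degN2 in degN'; rewrite Nb2 in Nb.
rewrite -[10%:R * eta * _]mulrA in degN'; rewrite -[11%:R * eta * _]mulrA.
lra.
Qed.

(** Here [e] counts the edges inside [B] and [c] the triples. From [r <= 25 eta n] and
    [k <= 44 eta n] follows [e <= 413 eta n^3], and [413 * 48 < 30000]. *)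
Lemma sparse_estimate n m r b k eta alpha (e c : R) :
    0 < eta -> eta <= 1 / 200%:R -> 30000%:R * eta < alpha -> 0 < n ->
    0 <= b -> 0 <= m -> 0 <= k -> n = 3%:R * m + r -> 0 <= r ->
    b + 4%:R / 9%:R * (n * r) <= 11%:R * eta * n ^+ 2 -> m * k <= b ->
    e <= n * (2%:R * (n * (r + 3%:R * k)) + 9%:R * b) -> n ^+ 3 <= 48%:R * c ->
  n / 4%:R <= m /\ e < alpha * c.
Proof.
move=> e0 e1 ea n0 b0 m0 k0 nE r0 br mk ek nc.
have nr : 0 <= n * r by rewrite mulr_ge0 // ltW.
have r25 : r <= 25%:R * (eta * n).
  rewrite -(ler_pM2l n0).
  have -> : n * (25%:R * (eta * n)) = 25%:R * (eta * n ^+ 2) by ring.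
  have : 0 <= eta * n ^+ 2 by rewrite mulr_ge0 ?exprn_ge0 ?(ltW n0) ?(ltW e0).
  by move: br; rewrite -[11%:R * eta * _]mulrA; lra.
have en : eta * n <= n / 200%:R by have := ler_wpM2r (ltW n0) e1; lra.
have m4 : n / 4%:R <= m by lra.
split=> //.
have b11 : b <= 11%:R * (eta * n ^+ 2) by rewrite mulrA; lra.
have k44 : k <= 44%:R * (eta * n).
  have n4 : 0 < n / 4%:R by rewrite divr_gt0.
  rewrite -(ler_pM2l n4).
  have -> : n / 4%:R * (44%:R * (eta * n)) = 11%:R * (eta * n ^+ 2) by field.
  by apply: le_trans b11; apply: le_trans mk; exact: ler_wpM2r.
have n3 : 0 < n ^+ 3 by rewrite exprn_gt0.
have en3 : e <= 413%:R * (eta * n ^+ 3).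
  apply: le_trans ek _.
  have -> : 413%:R * (eta * n ^+ 3) =
    n * (2%:R * (n * (25%:R * (eta * n) + 3%:R * (44%:R * (eta * n)))) +
         9%:R * (11%:R * (eta * n ^+ 2))).
    by ring.
  apply: ler_wpM2l; first exact: ltW.
  apply: lerD; last by lra.
  apply: ler_wpM2l => //; apply: ler_wpM2l; first exact: ltW.
  by lra.
have an3 : 30000%:R * (eta * n ^+ 3) < alpha * n ^+ 3 by rewrite mulrA ltr_pM2r.
have a0 : 0 < alpha by apply: le_lt_trans ea; rewrite mulr_ge0 // ltW.
have ac : alpha * n ^+ 3 <= 48%:R * (alpha * c).
  by rewrite [leRHS]mulrCA; apply: ler_wpM2l nc; exact: ltW.
have : 0 < eta * n ^+ 3 by rewrite mulr_gt0.
lra.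
Qed.

(** Each of [k], [k - 1], [k - 2] is at least [n / 2], the last one because [12 <= n]; and
    [48 = 8 * 6]. *)
Lemma bin3_lower (n k : nat) : (12 <= n)%N -> (2 * n <= 3 * k)%N ->
  n%:R ^+ 3 <= 48%:R * ('C(k, 3))%:R :> R.
Proof.
move=> n12 nk.
have : (n ^ 3 <= 48 * 'C(k, 3))%N.
  have h : ('C(k, 3) * 6 = k * (k.-1 * k.-2))%N.
    by rewrite -[6%N]/(3`!) bin_ffact !ffactnS ffactn0 muln1.
  have -> : (48 * 'C(k, 3) = 8 * ('C(k, 3) * 6))%N by rewrite [RHS]mulnCA [RHS]mulnC.
  have k1 : (n <= 2 * k)%N by lia.
  have k2 : (n <= 2 * k.-1)%N by lia.
  have k3 : (n <= 2 * k.-2)%N by lia.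
  rewrite h; have -> : (8 * (k * (k.-1 * k.-2)) = (2 * k) * ((2 * k.-1) * (2 * k.-2)))%N.
    by move: k.-1 k.-2 => x y; ring.
  by rewrite !expnS expn0 muln1 !leq_mul.
by rewrite -(ler_nat R) natrM natrX.
Qed.

End Estimates.

(** * Choice of the constants and conclusion *)

Theorem theorem2 (R : realType) :
  exists alpha0 : R, 0 < alpha0 /\
  forall alpha : R, 0 < alpha -> alpha < alpha0 ->
  exists eta0 : R, 0 < eta0 /\
  forall eta : R, 0 < eta -> eta < eta0 ->
  exists n0 : nat, forall n : nat, (n0 <= n)%N ->
  forall E : {set {set 'I_n}}, is_3graph E ->
    min_deg_ge E ((5%:R / 9%:R - 10%:R * eta) * ('C(n, 2))%:R) ->
    (exists M : {set {set 'I_n}}, is_matching E M /\ (unmatched M)%:R < eta ^+ 2 * n%:R)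
    \/ extremal alpha E.
Proof.
exists 1; split=> // alpha a0 a1; exists (alpha / 30000%:R); split; first by rewrite divr_gt0.
move=> eta e0 ea; have {}ea : 30000%:R * eta < alpha.
  by move: ea; rewrite ltr_pdivlMr // mulrC.
have e1 : eta <= 1 / 200%:R by lra.
have e3 : 0 < eta ^+ 3 by rewrite exprn_gt0.
(* The 12 serves [bin3_lower]; the other bound gives [eta ^+ 3 * n >= 10 ^ 6]. *)
exists (maxn 12 (Num.bound (10%:R ^+ 6 / eta ^+ 3))) => n.
rewrite geq_max => /andP[n12 nb] E E3 degE.
have nbig : 10%:R ^+ 6 <= eta ^+ 3 * n%:R.
  rewrite mulrC -ler_pdivrMr //; apply: le_trans (ltW (archi_boundP _)) _.
    by rewrite divr_ge0 ?exprn_ge0 // ltW.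
  by rewrite ler_nat.
have [M [ME tM maxM]] := exists_maximum_matching E.
have [small|large] := ltP (unmatched M)%:R (eta ^+ 2 * n%:R).
  by left; exists M; split=> //; split=> //; move/trivIsetP: tM.
right.
have v0 : 'I_n by exists 0%N; apply: leq_trans n12.
have nE : n%:R = 3%:R * #|M|%:R + (unmatched M)%:R :> R.
  by rewrite -natrM -natrD -(card_cover_split E3 ME tM) card_ord.
have cbin : n%:R * (n%:R - 1) = 2%:R * ('C(n, 2))%:R :> R.
  rewrite -natrM mulnC -[2%N in RHS]/(2`!) bin_ffact !ffactnS ffactn0 muln1 natrM.
  by case: n n12 {E E3 degE nbig M ME tM maxM large v0 nE nb} => // n _; rewrite -natr1 addrK.
set r := unmatched M in large nE *.
have degsum : r%:R * ((5%:R / 9%:R - 10%:R * eta) * (n%:R * (n%:R - 1))) <=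
    r%:R * (richsum E M)%:R + 18%:R * n%:R ^+ 2 :> R.
  have := uncovered_degree_sum M E3; rewrite -(ler_nat R) natrD 2!natrM natrX card_ord.
  apply: le_trans; rewrite cbin (mulrCA _ 2%:R) natr_sum mulr_natl -sumr_const.
  apply: ler_sum => x _; rewrite natrM ler_wpM2l //; exact: degE.
have tw := twostars_sum E3 ME tM maxM v0.
have Nb := richsum_bound E3 ME tM maxM v0.
set t := (\sum_(e in M) _)%N in tw Nb.
have est : (unlinked E M)%:R + 4%:R / 9%:R * (n%:R * r%:R) <= 11%:R * eta * n%:R ^+ 2.
  apply: (@deficiency_estimate R n%:R #|M|%:R r%:R (richsum E M)%:R _ t%:R) => //.
    by move: Nb; rewrite -(ler_nat R) !(natrX, natrD, natrM).
  move: tw; rewrite -(ler_nat R) !(natrX, natrM); lra.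
have n0 : 0 < n%:R :> R by rewrite ltr0n; apply: leq_trans n12.
(* Only [n / 4 <= m] is wanted from [sparse_estimate] here, so [k = e = 0] and [c = n ^+ 3] are
   inserted. *)
have M0 : (0 < #|M|)%N.
  have [|||m4 _] := @sparse_estimate R n%:R #|M|%:R r%:R (unlinked E M)%:R 0 eta alpha 0
    (n%:R ^+ 3) e0 e1 ea n0 (ler0n _ _) (ler0n _ _) (lexx _) nE (ler0n _ _) est.
  - by rewrite mulr0 ler0n.
  - by rewrite mulr0 addr0 !mulr_ge0 ?addr_ge0 ?mulr_ge0 ?ler0n.
  - by rewrite ler_peMl ?exprn_ge0 ?ler0n // ler1n.
  - by rewrite -(ltr0n R); apply: lt_le_trans m4; rewrite divr_gt0.
have [B [k [TB kM EB]]] := sparse_complement_of_centers E3 ME tM maxM M0.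
(* [B] omits at most [#|M|] vertices, and [3 * #|M| <= n]. *)
have nB : (2 * n <= 3 * #|B|)%N.
  have := card_cover_split E3 ME tM; move: TB; rewrite card_ord.
  by move: #|B| #|M| #|~: cover M| => x y z; clear; lia.
exists B; split.
  have : (2 * n)%:R <= (3 * #|B|)%:R :> R by rewrite ler_nat.
  rewrite !natrM; have := mulr_gt0 a0 n0; rewrite mulrBl; lra.
have nc := @bin3_lower R _ _ n12 nB.
have c0 : 0 < ('C(#|B|, 3))%:R :> R.
  have : 0 < n%:R ^+ 3 :> R by rewrite exprn_gt0.
  by lra.
rewrite /d3 ltr_pdivrMr //.
have [||//] := @sparse_estimate R n%:R #|M|%:R r%:R (unlinked E M)%:R k%:R eta alpha
  (#|[set h in E | h \subset B]|)%:R _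
  e0 e1 ea n0 (ler0n _ _) (ler0n _ _) (ler0n _ _) nE (ler0n _ _) est _ _ nc.
- by rewrite -natrM ler_nat.
- move: EB; rewrite card_ord -(ler_nat R); congr (_ <= _).
  by rewrite natrM natrD !natrM natrD natrM.
Qed.
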